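(* If $x^\star\in\mathcal X$ is an optimal interior-point allocation with margin $c>0$, then $\mathsf{OptiVal}(x^\star+\delta)=\mathsf{PessVal}(x^\star+\delta)=v_1^\star$ for all $\delta\in\mathbb R^{\mathcal S_d}$ with $\|\delta\|_1<c$.
   Context: Setting. $\mathcal S$ and $\mathcal A$ are finite nonempty sets (states, actions); $\mathcal T:\mathcal S\times\mathcal A\times\mathcal S\to[0,1]$ is a transition kernel ($\mathcal T(s,a,s')$ is the probability of moving from $s$ to $s'$ under action $a$); $r:\mathcal S\times\mathcal A\to\mathbb R$; $\gamma\in(0,1)$; $\rho$ is a probability distribution on $\mathcal S$ (initial distribution). A policy is $\pi:\mathcal S\times\mathcal A\to[0,1]$ with $\sum_a\pi(s,a)=1$ for all $s$. The occupancy measure induced by $\pi$ is $m^\pi(s,a)=\sum_{t\ge0}\gamma^t\,\mathbb P_\pi(s_t=s,a_t=a)$ with $s_0\sim\rho$. The set of occupancy measures is $\mathcal M=\{m\in\mathbb R^{\mathcal S\times\mathcal A}: m\ge0,\ \sum_a m(s,a)=\rho(s)+\gamma\sum_{s',a'}\mathcal T(s',a',s)m(s',a')\ \forall s\in\mathcal S\}$ (these are exactly the $m^\pi$). For $f\in\mathbb R^{\mathcal S\times\mathcal A}$, $\langle f,m\rangle=\sum_{s,a}f(s,a)m(s,a)$. $\mathcal S_d\subseteq\mathcal S$ is a nonempty set of states at which reward can be allocated; a reward allocation is $x\in\mathbb R^{\mathcal S_d}$; with budget $C\ge0$ the admissible allocations are $\mathcal X=\{x: x\ge0,\ \sum_{s\in\mathcal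 S_d}x(s)\le C\}$. The follower's modified reward is $r_2^x(s,a)=r(s,a)+x(s)$ if $s\in\mathcal S_d$ and $r_2^x(s,a)=r(s,a)$ otherwise. The leader's reward is $r_1(s,a)=1$ if $s\in\mathcal S_d$ and $0$ otherwise. Best responses: $\mathsf{BR}(x)=\arg\max_{m\in\mathcal M}\langle r_2^x,m\rangle$, for any $x\in\mathbb R^{\mathcal S_d}$. The reward design problem is: maximize $\langle r_1,m\rangle$ over $x\in\mathcal X$, $m\in\mathcal M$ subject to $m\in\mathsf{BR}(x)$; its optimal value is $v_1^\star$; if $(x,m)$ is an optimal solution, $x$ is called an optimal allocation and $m$ an optimal occupancy measure. For any $x\in\mathbb R^{\mathcal S_d}$: $\mathsf{OptiVal}(x)=\max_{m\in\mathsf{BR}(x)}\langle r_1,m\rangle$ and $\mathsf{PessVal}(x)=\min_{m\in\mathsf{BR}(x)}\langle r_1,m\rangle$. The allocation region of $m\in\mathcal M$ is $\mathcal P_m=\{x\in\mathbb R^{\mathcal S_d}: m\in\mathsf{BR}(x)\}$; it is an optimal allocation region if $m$ is an optimal occupancy measure. $x\in\mathcal X$ is an interior-point allocation of $\mathcal P_m$ if there is $c>0$ with $x+cv\in\mathcal P_m$ for all $v\in\mathbb R^{\mathcal S_d}$ with $\|v\|_1\le1$; the largest such $c$ is the margin of $x$. An optimal interior-point allocation is an interior-point allocation of some optimal allocation region (and its margin is taken with respect to that region). *)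

(* Defs.v *)
From HB Require Import structures.
From mathcomp Require Import all_boot all_order all_algebra.
From mathcomp Require Import boolp classical_sets reals.

Set Implicit Arguments.
Unset Strict Implicit.
Unset Printing Implicit Defensive.
Import Order.TTheory GRing.Theory Num.Theory.
Local Open Scope classical_set_scope.
Local Open Scope ring_scope.

Record reward_design (R : realType) (S A : finType) := RewardDesign {
  trans : S -> A -> S -> R;
  reward : {ffun S * A -> R};
  discount : R;
  init : S -> R;
  design_states : {set S};
  budget : R;
  states_nonempty : (0 < #|S|)%N;
  actions_nonempty : (0 < #|A|)%N;
  trans_ge0 : forall s a s', 0 <= trans s a s';
  trans_sum1 : forall s a, \sum_s' trans s a s' = 1;
  discount_gt0 : 0 < discount;
  discount_lt1 : discount < 1;
  init_ge0 : forall s, 0 <= init s;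
  init_sum1 : \sum_s init s = 1;
  design_states_nonempty : (0 < #|design_states|)%N;
  budget_ge0 : 0 <= budget
}.

Definition is_maximum (R : realType) (E : set R) (v : R) := E v /\ ubound E v.
Definition is_minimum (R : realType) (E : set R) (v : R) := E v /\ lbound E v.

Section RewardDesign.
Context {R : realType} {S A : finType} (P : reward_design R S A).

Definition allocation := {ffun {s : S | s \in design_states P} -> R}.

Definition l1norm (v : allocation) : R := \sum_d `|v d|.

Definition dot (f m : {ffun S * A -> R}) : R := \sum_p f p * m p.

(* The polytope cut out by the discounted flow equations; its points are
   exactly the discounted occupancy measures of the policies. *)
Definition occupancy : set {ffun S * A -> R} :=
  [set m | (forall p, 0 <= m p) /\
           forall s, \sum_a m (s, a) =
             init P s + discount P * \sum_s' \sum_a' trans P s' a' s * m (s', a')].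

Definition admissible : set allocation :=
  [set x | (forall d, 0 <= x d) /\ \sum_d x d <= budget P].

(* [insub s] is [None] when [s] is not a design state. *)
Definition follower_reward (x : allocation) : {ffun S * A -> R} :=
  [ffun p => if insub p.1 is Some d then reward P p + x d else reward P p].

Definition leader_reward : {ffun S * A -> R} :=
  [ffun p => if p.1 \in design_states P then 1 else 0].

Definition best_response (x : allocation) : set {ffun S * A -> R} :=
  [set m | occupancy m /\
           forall m', occupancy m' ->
             dot (follower_reward x) m' <= dot (follower_reward x) m].

Definition feasible (x : allocation) (m : {ffun S * A -> R}) :=
  [/\ admissible x, occupancy m & best_response x m].

Definition optimal_solution (x : allocation) (m : {ffun S * A -> R}) :=
  feasible x m /\
  forall x' m', feasible x' m' -> dot leader_reward m' <= dot leader_reward m.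

Definition optimal_value : R :=
  sup [set v | exists x m, feasible x m /\ v = dot leader_reward m].

Definition optimal_occupancy (m : {ffun S * A -> R}) :=
  exists x, optimal_solution x m.

(* The values of a maximum and of a minimum are given as relations, so that
   attainment is part of what they assert. *)
Definition is_optival (x : allocation) (v : R) :=
  is_maximum [set dot leader_reward m | m in best_response x] v.

Definition is_pessval (x : allocation) (v : R) :=
  is_minimum [set dot leader_reward m | m in best_response x] v.

Definition allocation_region (m : {ffun S * A -> R}) : set allocation :=
  [set x | best_response x m].

Definition ball_in_region (m : {ffun S * A -> R}) (x : allocation) (c : R) :=
  0 < c /\
  forall v : allocation, l1norm v <= 1 ->
    allocation_region m [ffun d => x d + c * v d].

Definition interior_point (m : {ffun S * A -> R}) (x : allocation) :=
  admissible x /\ exists c, ball_in_region m x c.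

(* No real number is a margin of [x] when the region is the whole space. *)
Definition is_margin (m : {ffun S * A -> R}) (x : allocation) (c : R) :=
  is_maximum [set c' | ball_in_region m x c'] c.

Definition optimal_interior_point_with_margin (x : allocation) (c : R) :=
  exists m, [/\ optimal_occupancy m, interior_point m x & is_margin m x c].

End RewardDesign.

(* Main.v *)
Require Import Defs.
From HB Require Import structures.
From mathcomp Require Import all_boot all_order all_algebra.
From mathcomp Require Import boolp classical_sets reals.

(* The region's measure [m] stays a best response after any perturbation of
   l1-norm at most [c].  If [m'] is a best response at [xstar + delta] with
   [l1norm delta < c], shift the allocation at all design states by a small
   common amount [t] of either sign: this adds [t * leader_reward] to the
   follower's reward, and [m] must still do at least as well as [m'].  Hence
   [m] and [m'] have the same leader value. *)

Set Implicit Arguments.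
Unset Strict Implicit.
Unset Printing Implicit Defensive.
Import Order.TTheory GRing.Theory Num.Theory.
Local Open Scope classical_set_scope.
Local Open Scope ring_scope.

Lemma dotDZl (R : realType) (S A : finType) (f g m : {ffun S * A -> R}) (t : R) :
  dot [ffun p => f p + t * g p] m = dot f m + t * dot g m.
Proof.
rewrite /dot mulr_sumr -big_split; apply: eq_bigr => p _ /=.
by rewrite ffunE mulrDl mulrA.
Qed.

Section AllocationRegions.
Context {R : realType} {S A : finType} {P : reward_design R S A}.
Implicit Types (x y : allocation P) (m : {ffun S * A -> R}).

Lemma l1normD x y : l1norm (x + y) <= l1norm x + l1norm y.
Proof.
rewrite /l1norm -big_split; apply: ler_sum => d _ /=.
by rewrite ffunE ler_normD.
Qed.

(** [leader_reward] is the indicator of the design states, exactly where a constant allocation pays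
    [t]. *)
Lemma follower_reward_shift x (t : R) :
  follower_reward (x + [ffun=> t]) =
    [ffun p => follower_reward x p + t * leader_reward P p].
Proof.
apply/ffunP => p; rewrite !ffunE.
case: insubP => [d -> _|/negbTE ->]; last by rewrite mulr0 addr0.
by rewrite !ffunE mulr1 addrA.
Qed.

Lemma ball_in_region_best_response m x c delta :
  ball_in_region m x c -> l1norm delta <= c -> best_response (x + delta) m.
Proof.
move=> [c_gt0 ball] delta_le.
(* The direction [delta / c] lies in the closed unit l1-ball, so the boundary case
   [l1norm delta = c] is covered. *)
have -> : x + delta = [ffun d => x d + c * [ffun e => delta e / c] d].
  by apply/ffunP => d; rewrite !ffunE mulrC divfK ?gt_eqF.
apply: ball; rewrite /l1norm.
under eq_bigr do rewrite ffunE normrM normfV (gtr0_norm c_gt0).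
by rewrite -mulr_suml ler_pdivrMr ?mul1r.
Qed.

(** Two best responses tie at [x], so after the shift only the added leader term separates them. The
    sign of [t] is left free so that both directions can be drawn from it. *)
Lemma best_response_shift_le m m' x (t : R) :
  best_response x m -> best_response x m' ->
  best_response (x + [ffun=> t]) m ->
  t * dot (leader_reward P) m' <= t * dot (leader_reward P) m.
Proof.
move=> [occ_m max_m] [occ_m' max_m'] [_ max_t].
have := max_t _ occ_m'; rewrite follower_reward_shift !dotDZl.
suff -> : dot (follower_reward x) m' = dot (follower_reward x) m.
  by rewrite lerD2l.
by apply/eqP; rewrite eq_le max_m // max_m'.
Qed.

Lemma leader_value_inside_ball m m' x c delta :
  ball_in_region m x c -> l1norm delta < c -> best_response (x + delta) m' ->
  dot (leader_reward P) m' = dot (leader_reward P) m.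
Proof.
move=> ball delta_lt br_m'.
have br_m := ball_in_region_best_response ball (ltW delta_lt).
pose N := #|{: {s : S | s \in design_states P}}|.
(* A shift by [t] at each of the [N] design states costs [N * t] in l1-norm, which fits in the slack
   [c - l1norm delta]; the divisor [N.+1] is visibly nonzero. *)
pose t := (c - l1norm delta) / N.+1%:R.
have t_gt0 : 0 < t by rewrite divr_gt0 ?subr_gt0 ?ltr0Sn.
have shift u : `|u| = t ->
    u * dot (leader_reward P) m' <= u * dot (leader_reward P) m.
  move=> u_t; apply: best_response_shift_le br_m br_m' _.
  rewrite -addrA; apply: ball_in_region_best_response ball _.
  apply: le_trans (l1normD _ _) _; rewrite -lerBrDl /l1norm.
  under eq_bigr do rewrite ffunE u_t.
  rewrite sumr_const -/N -mulr_natr.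
  have -> : c - \sum_d `|delta d| = t * N.+1%:R by rewrite divfK ?pnatr_eq0.
  by rewrite ler_pM2l // ler_nat.
(* Taking [u = t] gives one inequality and [u = - t] the reverse. *)
apply/eqP; rewrite eq_le; apply/andP; split.
  by rewrite -(ler_pM2l t_gt0) shift // gtr0_norm.
have := shift (- t); rewrite normrN gtr0_norm // !mulNr lerN2 ler_pM2l //.
exact.
Qed.

Lemma optimal_valueE m :
  optimal_occupancy P m -> optimal_value P = dot (leader_reward P) m.
Proof.
move=> [x [feas_m max_m]]; rewrite /optimal_value; set E := (X in sup X).
have Em : E (dot (leader_reward P) m) by exists x, m.
have ubE : ubound E (dot (leader_reward P) m).
  by move=> _ [x' [m' [feas_m' ->]]]; apply: max_m feas_m'.
apply/eqP; rewrite eq_le ge_sup ?ub_le_sup //; first by exists (dot (leader_reward P) m).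
by exists (dot (leader_reward P) m).
Qed.

End AllocationRegions.

Theorem proposition7 (R : realType) (S A : finType) (P : reward_design R S A)
    (xstar : allocation P) (c : R)
    (xstar_admissible : admissible xstar)
    (c_gt0 : 0 < c)
    (xstar_interior : optimal_interior_point_with_margin xstar c) :
  forall delta : allocation P, l1norm delta < c ->
    is_optival (xstar + delta) (optimal_value P) /\
    is_pessval (xstar + delta) (optimal_value P).
Proof.
move=> delta delta_lt; case: xstar_interior => m [opt_m _ [ball _]].
rewrite (optimal_valueE opt_m).
have br_m := ball_in_region_best_response ball (ltW delta_lt).
have value_eq := leader_value_inside_ball ball delta_lt.
(* All best responses share the value of [m], so it is both maximum and minimum, attained at [m]
   itself. *)
by split; (split; first by exists m) => _ [m' /value_eq <- <-].
Qed.
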